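(* Suppose $P_i\in\mathbb{R}^{N\times N}$, $i=1,\dots,n$, are projection matrices. Then $$\frac1{n!}\sum_{\sigma=(\sigma_1,\dots,\sigma_n)\in\Gamma}P_{\sigma_n}P_{\sigma_{n-1}}\cdots P_{\sigma_1}\preceq\frac1n\sum_{i=1}^nP_i .$$
   Context: $\Gamma$ is the set of all permutations of $\{1,\dots,n\}$. A projection matrix means an orthogonal projection: $P_i=P_i^T=P_i^2$. For real symmetric matrices, $X\preceq Y$ means $Y-X$ is positive semidefinite. *)

(* Defs.v *)
From mathcomp Require Import all_boot all_order perm all_algebra.
From mathcomp Require Import reals.

Set Implicit Arguments.
Unset Strict Implicit.
Unset Printing Implicit Defensive.

Import GRing.Theory Num.Theory.
Local Open Scope ring_scope.

Definition is_projection (R : realType) (N : nat) (P : 'M[R]_N) : Prop :=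
  P = P^T /\ P = P ^+ 2.

(* Symmetry is part of positive semidefiniteness, as the order below is only
   meant for symmetric matrices. The [0 0] reads off the entry of a 1 x 1
   matrix. *)
Definition psd (R : realType) (N : nat) (A : 'M[R]_N) : Prop :=
  A^T = A /\ forall x : 'cV[R]_N, 0 <= (x^T *m A *m x) 0 0.

Definition loewner_le (R : realType) (N : nat) (X Y : 'M[R]_N) : Prop :=
  psd (Y - X).

(* The product is taken from left to right in increasing [i], so reversing the
   index makes [P (s ord_max)] the leftmost factor and [P (s ord0)] the
   rightmost. *)
Definition perm_prod (R : realType) (N n : nat) (P : 'I_n -> 'M[R]_N)
    (s : 'S_n) : 'M[R]_N :=
  \prod_(i < n) P (s (rev_ord i)).

(* Main.v *)
Require Import Defs.
From mathcomp Require Import all_boot all_order perm all_algebra.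
From mathcomp Require Import reals.
From mathcomp Require Import ring lra.
Local Open Scope ring_scope.

(** Write [q_i = x^T P_i x = |P_i x|^2]. In the quadratic form of one product,
    [x^T P_b M P_a x = <P_b x, M P_a x>], the middle factor [M] is a product of
    projections and so does not increase norms. Cauchy-Schwarz in its
    arithmetic-mean form then gives [x^T P_b M P_a x <= (q_b + q_a) / 2]: only
    the two outer factors count ([quad_sandwich_le], [quad_perm_prod_le]).
    Under a uniformly random permutation the first and the last index are each
    uniformly distributed ([sum_perm_eval]), so averaging the bound yields the
    mean of the [q_i].

    The average of the products is symmetric, because transposing a product of
    symmetric matrices reverses it and reversal permutes the summands
    ([perm_prod_tr]). *)

Set Implicit Arguments.
Unset Strict Implicit.
Unset Printing Implicit Defensive.

Import Order.TTheory GRing.Theory Num.Theory.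

Section SumPerm.

Variables (V : zmodType) (n : nat) (f : 'I_n -> V).

(** Composing with the transposition of [i] and [j] is a bijection of the
    symmetric group that moves the value at [i] to [j]. *)
Lemma sum_perm_eval_const (i j : 'I_n) :
  \sum_(s : 'S_n) f (s i) = \sum_(s : 'S_n) f (s j).
Proof.
rewrite (reindex_inj (mulgI (tperm i j))) /=.
by apply: eq_bigr => s _; rewrite permM tpermL.
Qed.

(** Since the left-hand sum does not depend on [i], [n] times it is the sum
    over all [i]; exchanging summations, every permutation contributes the
    full sum of [f]. *)
Lemma sum_perm_eval (i : 'I_n) :
  (\sum_(s : 'S_n) f (s i)) *+ n = (\sum_j f j) *+ n`!.
Proof.
transitivity (\sum_(j < n) \sum_(s : 'S_n) f (s j)).
  rewrite [RHS](eq_bigr (fun=> \sum_(s : 'S_n) f (s i))) => [|j _].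
    by rewrite sumr_const card_ord.
  exact: sum_perm_eval_const.
rewrite exchange_big /= (eq_bigr (fun=> \sum_j f j)) => [|s _].
  by rewrite sumr_const card_Sn.
by rewrite [RHS](reindex_inj (@perm_inj _ s)).
Qed.

End SumPerm.

Lemma trmx_prod (R : comPzRingType) (N n : nat) (A : 'I_n -> 'M[R]_N) :
  (\prod_(i < n) A i)^T = \prod_(i < n) (A (rev_ord i))^T.
Proof.
elim: n A => [|n IHn] A; first by rewrite !big_ord0 trmx1.
rewrite big_ord_recr big_ord_recl /= -!mulmxE trmx_mul IHn.
congr (_^T *m _); first by congr A; apply: val_inj; rewrite /= subn1.
by apply: eq_bigr => i _; congr (_^T); congr A; apply: val_inj.
Qed.

Section Quadratic.

Variables (R : realType) (N : nat).
Implicit Types (A B M : 'M[R]_N) (u v x : 'cV[R]_N).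

Definition dot u v : R := (u^T *m v) 0 0.

Definition contraction M := forall x, dot (M *m x) (M *m x) <= dot x x.

Lemma dotC u v : dot u v = dot v u.
Proof. by rewrite /dot -[in LHS](trmxK v) -trmx_mul mxE. Qed.

Lemma dotBr u v w : dot u (v - w) = dot u v - dot u w.
Proof. by rewrite /dot mulmxBr !mxE. Qed.

Lemma dot_ge0 u : 0 <= dot u u.
Proof.
by rewrite /dot mxE sumr_ge0 // => i _; rewrite mxE -expr2 sqr_ge0.
Qed.

Lemma dot_sub u v : dot (u - v) (u - v) = dot u u - 2 * dot u v + dot v v.
Proof.
by rewrite dotBr !(dotC (u - v)) !dotBr (dotC v u); ring.
Qed.

Lemma dot_le_mean u v : dot u v <= (dot u u + dot v v) / 2.
Proof. by have := dot_ge0 (u - v); rewrite dot_sub; lra. Qed.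

Lemma dot_mulmxl A u v : dot (A *m u) v = dot u (A^T *m v).
Proof. by rewrite /dot trmx_mul mulmxA. Qed.

Lemma dot_projection A x :
  is_projection A -> dot (A *m x) (A *m x) = dot x (A *m x).
Proof.
by case=> sA iA; rewrite dot_mulmxl -sA mulmxA mulmxE -expr2 -iA.
Qed.

(** Pythagoras: [|x|^2 = |A x|^2 + |x - A x|^2]. *)
Lemma contraction_projection A : is_projection A -> contraction A.
Proof.
move=> pA x; have := dot_ge0 (x - A *m x).
by rewrite dot_sub dot_projection //; lra.
Qed.

Lemma contraction1 : contraction 1.
Proof. by move=> x; rewrite mul1mx. Qed.

Lemma contractionM A B : contraction A -> contraction B -> contraction (A * B).
Proof.
by move=> cA cB x; rewrite -mulmxE -mulmxA; apply: le_trans (cA _) (cB x).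
Qed.

(** Moving [A] to the left of the inner product leaves [<A x, M B x>], which is
    at most [(|A x|^2 + |M B x|^2) / 2]; now use [|M B x| <= |B x|] and
    [|A x|^2 = x^T A x]. *)
Lemma quad_sandwich_le A M B x :
    is_projection A -> contraction M -> is_projection B ->
  dot x ((A * (M * B)) *m x) <= (dot x (A *m x) + dot x (B *m x)) / 2.
Proof.
move=> pA cM pB; have [sA _] := pA.
rewrite -!mulmxE -!mulmxA {1}sA -dot_mulmxl.
apply: le_trans (dot_le_mean _ _) _.
by have := cM (B *m x); rewrite (dot_projection _ pA) (dot_projection _ pB); lra.
Qed.

Lemma dot_sum (I : finType) (F : I -> 'M[R]_N) x :
  dot x ((\sum_i F i) *m x) = \sum_i dot x (F i *m x).
Proof. by rewrite /dot mulmx_suml mulmx_sumr summxE. Qed.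

Lemma dot_scale c A x : dot x ((c *: A) *m x) = c * dot x (A *m x).
Proof. by rewrite /dot -scalemxAl -scalemxAr mxE. Qed.

Variables (n : nat) (P : 'I_n.+1 -> 'M[R]_N).
Hypothesis projP : forall i, is_projection (P i).

(** The factors strictly between the first and the last form the contraction of
    [quad_sandwich_le]. *)
Lemma quad_perm_prod_le (s : 'S_n.+1) x :
  dot x (perm_prod P s *m x)
    <= (dot x (P (s ord_max) *m x) + dot x (P (s ord0) *m x)) / 2.
Proof.
suff [M cM ->] : exists2 M, contraction M &
    perm_prod P s = P (s ord_max) * (M * P (s ord0)).
  exact: quad_sandwich_le.
rewrite /perm_prod; case: n P projP s => [|m] Q pQ s.
  (* A single factor is both the first and the last: use [Q = Q * 1 * Q]. *)
  exists 1; first exact: contraction1.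
  rewrite big_ord1 mul1r !(ord1 (rev_ord _)) !(ord1 ord_max) -expr2.
  by case: (pQ (s 0)).
rewrite big_ord_recl big_ord_recr /=.
have -> : rev_ord (ord0 : 'I_m.+2) = ord_max.
  by apply: val_inj; rewrite /= subn1.
have -> : rev_ord (lift ord0 (ord_max : 'I_m.+1)) = ord0.
  by apply: val_inj; rewrite /= /bump /= add1n subnn.
eexists; last by [].
apply: big_ind; [exact: contraction1 | exact: contractionM |].
by move=> i _; apply: contraction_projection.
Qed.

End Quadratic.

Lemma perm_prod_tr (R : realType) (N n : nat) (P : 'I_n -> 'M[R]_N) (s : 'S_n) :
    (forall i, is_projection (P i)) ->
  (perm_prod P s)^T = perm_prod P (perm (@rev_ord_inj n) * s)%g.
Proof.
move=> hP; rewrite /perm_prod trmx_prod; apply: eq_bigr => i _.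
by rewrite permM permE; case: (hP (s (rev_ord (rev_ord i)))) => <-.
Qed.

Theorem lemma3 (R : realType) (N n : nat) (hn : (0 < n)%N)
    (P : 'I_n -> 'M[R]_N) (hP : forall i, is_projection (P i)) :
  loewner_le ((n`!%:R)^-1 *: \sum_(s : 'S_n) perm_prod P s)
             (n%:R^-1 *: \sum_(i < n) P i).
Proof.
split.
  rewrite linearB; congr (_ - _); rewrite linearZ; congr (_ *: _);
    rewrite linear_sum /=.
    by apply: eq_bigr => i _; case: (hP i) => <-.
  rewrite [RHS](reindex_inj (mulgI (perm (@rev_ord_inj n)))) /=.
  by apply: eq_bigr => s _; apply: perm_prod_tr.
case: n hn P hP => // n _ P hP x.
rewrite -mulmxA -/(dot x _) mulmxBl dotBr !dot_scale !dot_sum subr_ge0.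
set q := fun i => dot x (P i *m x).
have mean_eval i :
    (n.+1`!)%:R^-1 * \sum_(s : 'S_n.+1) q (s i) = n.+1%:R^-1 * \sum_j q j.
  have n0 : n.+1%:R != 0 :> R by rewrite pnatr_eq0.
  have f0 : n.+1`!%:R != 0 :> R by rewrite pnatr_eq0 -lt0n fact_gt0.
  apply: (mulfI f0); apply: (mulfI n0).
  rewrite mulVKf // mulrCA mulVKf // !mulr_natl.
  exact: sum_perm_eval.
have: \sum_(s : 'S_n.+1) dot x (perm_prod P s *m x)
    <= \sum_(s : 'S_n.+1) (q (s ord_max) + q (s ord0)) / 2.
  by apply: ler_sum => s _; apply: quad_perm_prod_le.
rewrite -mulr_suml big_split /=.
have f_ge0 : 0 <= (n.+1`!)%:R^-1 :> R by rewrite invr_ge0 ler0n.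
move/(ler_wpM2l f_ge0) => /le_trans; apply.
by rewrite mulrA mulrDr !mean_eval mulrDl -splitr.
Qed.
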